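(* Let $\Gamma$ be a finite set of formulas of $\mathcal L_J$ and $A\in\mathcal L_J$. (i) If $\mathbf{MS}\vDash\Gamma\Rightarrow A$ then $\Gamma\vdash_{\mathbf{mJ}}A$. (ii) If $\mathbf{sCoTS}\vDash\Gamma\Rightarrow A$ then $\Gamma\vdash_{\mathbf{sCoJ}}A$. (iii) If $\mathbf{CoTS}\vDash\Gamma\Rightarrow A$ then $\Gamma\vdash_{\mathbf{CoJ}}A$. (iv) If $\mathbf{TS}\vDash\Gamma\Rightarrow A$ then $\Gamma\vdash_{\mathbf{J}}A$. (v) If $\mathbf{sS}\vDash\Gamma\Rightarrow A$ then $\Gamma\vdash_{\mathbf{sI}}A$. (vi) If $\mathbf{S}\vDash\Gamma\Rightarrow A$ then $\Gamma\vdash_{\mathbf{I}}A$.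
   Context: $\mathcal L_J$: formulas built from atoms, $\top,\bot$ by $\wedge,\vee,\to$ and a unary operator $J$. Sequents $\Gamma\vdash A$ have $\Gamma$ a finite set of formulas; initial sequents are $A\vdash A$. Rules (premises / conclusion): ($F$) $C\vdash A\ /\ JC\vdash JA$ (exactly one formula on the left). (cut) $\Gamma_0\vdash A$ and $\Gamma_1,A\vdash B\ /\ \Gamma_0,\Gamma_1\vdash B$. ($\top$) $/\ \Gamma\vdash\top$. ($\bot$) $\Gamma\vdash\bot\ /\ \Gamma\vdash A$. ($\vee E$) $\Gamma_0,A\vdash C$ and $\Gamma_1,B\vdash C\ /\ \Gamma_0,\Gamma_1,A\vee B\vdash C$. ($\vee I$) $\Gamma\vdash A_i\ /\ \Gamma\vdash A_0\vee A_1$ ($i=0,1$). ($\wedge E$) $\Gamma\vdash A_0\wedge A_1\ /\ \Gamma\vdash A_i$ ($i=0,1$). ($\wedge I$) $\Gamma_0\vdash A$ and $\Gamma_1\vdash B\ /\ \Gamma_0,\Gamma_1\vdash A\wedge B$. ($\to E$) $\Gamma_0\vdash A$ and $\Gamma_1\vdash J(A\to B)\ /\ \Gamma_0,\Gamma_1\vdash B$. ($\to I$) $JC,A\vdash B\ /\ C\vdash A\to B$ (exactly one formula $C$). Additional rules: ($sCoJ$) $JA\vdash\bot\ /\ A\vdash\bot$; ($CoJ$) $\Gamma\vdash A\ /\ \Gamma\vdash JA$; ($J$) $\Gamma\vdash JA\ /\ \Gamma\vdash A$. Logics: $\mathbf{mJ}$ has all rules except the additional ones; $\mathbf{sCoJ}=\mathbf{mJ}+(sCoJ)$;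 $\mathbf{CoJ}=\mathbf{mJ}+(CoJ)$; $\mathbf J=\mathbf{mJ}+(J)$; $\mathbf{sI}=\mathbf{mJ}+(sCoJ)+(J)$; $\mathbf I=\mathbf{mJ}+(J)+(CoJ)$. A locale $X$ is identified with its frame (complete lattice with finite meets distributing over arbitrary joins). A modal space is a pair $(X,J)$ with $X$ a locale and $J:X\to X$ monotone and preserving all joins; $a\rightarrow_Jb=\bigvee\{d: Jd\wedge a\le b\}$. Classes: $\mathbf{MS}$: all modal spaces; $\mathbf{sCoTS}$: $Ja=0$ implies $a=0$; $\mathbf{TS}$: $Ja\le a$ for all $a$; $\mathbf{CoTS}$: $a\le Ja$ for all $a$; $\mathbf{sS}=\mathbf{sCoTS}\cap\mathbf{TS}$; $\mathbf S=\mathbf{TS}\cap\mathbf{CoTS}$. A topological model is $(X,J,V)$ with $(X,J)$ a modal space and $V:\mathcal L_J\to X$ with $V(\top)=1$, $V(\bot)=0$, $V(A\wedge B)=V(A)\wedge V(B)$, $V(A\vee B)=V(A)\vee V(B)$, $V(A\to B)=V(A)\rightarrow_JV(B)$, $V(JA)=JV(A)$. $\mathcal C\vDash\Gamma\Rightarrow A$ means $\bigwedge_{\gamma\in\Gamma}V(\gamma)\le V(A)$ for every model with $(X,J)\in\mathcal C$. *)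

(* Defs.v *)
From HB Require Import structures.
From mathcomp Require Import all_boot all_order.
From mathcomp Require Import finmap.
From mathcomp Require Import boolp classical_sets.

Set Implicit Arguments.
Unset Strict Implicit.
Unset Printing Implicit Defensive.

Declare Scope form_scope.
Delimit Scope form_scope with form.

Inductive form (P : Type) : Type :=
| Atom of P
| Top
| Bot
| And of form P & form P
| Or of form P & form P
| Imp of form P & form P
| J of form P.

Arguments Top {P}.
Arguments Bot {P}.
Bind Scope form_scope with form.

Notation "⊤" := Top : form_scope.
Notation "⊥" := Bot : form_scope.
Notation "A ∧ B" := (And A%form B%form)
  (at level 80, right associativity) : form_scope.
Notation "A ∨ B" := (Or A%form B%form)
  (at level 85, right associativity) : form_scope.
Notation "A → B" := (Imp A%form B%form)
  (at level 99, right associativity) : form_scope.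

(* An encoding of formulas as trees, so that [form P] is a [choiceType] and
   {fset form P} makes sense. *)
Fixpoint tree_of_form P (A : form P) : GenTree.tree P :=
  match A with
  | Atom p => GenTree.Leaf p
  | Top => GenTree.Node 0 [::]
  | Bot => GenTree.Node 1 [::]
  | And A B => GenTree.Node 2 [:: tree_of_form A; tree_of_form B]
  | Or A B => GenTree.Node 3 [:: tree_of_form A; tree_of_form B]
  | Imp A B => GenTree.Node 4 [:: tree_of_form A; tree_of_form B]
  | J A => GenTree.Node 5 [:: tree_of_form A]
  end.

Fixpoint form_of_tree P (t : GenTree.tree P) : form P :=
  match t with
  | GenTree.Leaf p => Atom p
  | GenTree.Node 0 [::] => Top
  | GenTree.Node 2 [:: s; t] => And (form_of_tree s) (form_of_tree t)
  | GenTree.Node 3 [:: s; t] => Or (form_of_tree s) (form_of_tree t)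
  | GenTree.Node 4 [:: s; t] => Imp (form_of_tree s) (form_of_tree t)
  | GenTree.Node 5 [:: s] => J (form_of_tree s)
  | _ => Bot
  end.

Lemma tree_of_formK P : cancel (@tree_of_form P) (@form_of_tree P).
Proof. by elim=> //= [A -> B ->|A -> B ->|A -> B ->|A ->]. Qed.

HB.instance Definition _ (P : choiceType) :=
  Choice.copy (form P) (can_type (@tree_of_formK P)).

Variant rule := rsCoJ | rCoJ | rJ.

(* A logic is mJ extended by a set of additional rules. *)
Definition logic := set rule.

Definition mJ   : logic := set0.
Definition sCoJ : logic := [set rsCoJ]%classic.
Definition CoJ  : logic := [set rCoJ]%classic.
Definition LJ   : logic := [set rJ]%classic.
Definition sI   : logic := [set rsCoJ; rJ]%classic.
Definition LI   : logic := [set rJ; rCoJ]%classic.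

Section Derivability.
Local Open Scope fset_scope.

Inductive derivable (P : choiceType) (L : logic) :
    {fset form P} -> form P -> Prop :=
| d_init (A : form P) : derivable L [fset A] A
| d_F (C A : form P) :
    derivable L [fset C] A -> derivable L [fset J C] (J A)
| d_cut (Γ0 Γ1 : {fset form P}) (A B : form P) :
    derivable L Γ0 A -> derivable L (A |` Γ1) B -> derivable L (Γ0 `|` Γ1) B
| d_top (Γ : {fset form P}) : derivable L Γ ⊤
| d_bot (Γ : {fset form P}) (A : form P) : derivable L Γ ⊥ -> derivable L Γ A
| d_orE (Γ0 Γ1 : {fset form P}) (A B C : form P) :
    derivable L (A |` Γ0) C -> derivable L (B |` Γ1) C ->
    derivable L ((A ∨ B)%form |` (Γ0 `|` Γ1)) C
| d_orI0 (Γ : {fset form P}) (A0 A1 : form P) :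
    derivable L Γ A0 -> derivable L Γ (A0 ∨ A1)
| d_orI1 (Γ : {fset form P}) (A0 A1 : form P) :
    derivable L Γ A1 -> derivable L Γ (A0 ∨ A1)
| d_andE0 (Γ : {fset form P}) (A0 A1 : form P) :
    derivable L Γ (A0 ∧ A1) -> derivable L Γ A0
| d_andE1 (Γ : {fset form P}) (A0 A1 : form P) :
    derivable L Γ (A0 ∧ A1) -> derivable L Γ A1
| d_andI (Γ0 Γ1 : {fset form P}) (A B : form P) :
    derivable L Γ0 A -> derivable L Γ1 B -> derivable L (Γ0 `|` Γ1) (A ∧ B)
| d_impE (Γ0 Γ1 : {fset form P}) (A B : form P) :
    derivable L Γ0 A -> derivable L Γ1 (J (A → B)) ->
    derivable L (Γ0 `|` Γ1) B
| d_impI (C A B : form P) :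
    derivable L [fset J C; A] B -> derivable L [fset C] (A → B)
| d_sCoJ (A : form P) :
    L rsCoJ -> derivable L [fset J A] ⊥ -> derivable L [fset A] ⊥
| d_CoJ (Γ : {fset form P}) (A : form P) :
    L rCoJ -> derivable L Γ A -> derivable L Γ (J A)
| d_J (Γ : {fset form P}) (A : form P) :
    L rJ -> derivable L Γ (J A) -> derivable L Γ A.

End Derivability.

Notation "Γ ⊢[ L ] A" := (derivable L Γ A%form)
  (at level 70, L at level 50, A at level 70, no associativity).

(* Distributivity of the underlying lattice is a special case of [meet_bigsup]. *)
HB.mixin Record TBLattice_isFrame d T of Order.TBLattice d T := {
  bigsup : set T -> T;
  bigsup_isLub : forall S : set T, isLub S (bigsup S);
  meet_bigsup : forall (a : T) (S : set T),
    (a `&` bigsup S = bigsup [set (a `&` b)%O | b in S]%classic)%O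
}.

#[short(type="frameType")]
HB.structure Definition Frame d :=
  { T of TBLattice_isFrame d T & Order.TBLattice d T }.

Record modalSpace := ModalSpace {
  ms_disp : Order.disp_t;
  ms_locale :> frameType ms_disp;
  ms_J : ms_locale -> ms_locale;
  ms_J_mono : {homo ms_J : a b / (a <= b)%O};
  ms_J_bigsup : forall S : set ms_locale,
    ms_J (bigsup S) = bigsup [set ms_J a | a in S]%classic
}.

Definition jimp (X : modalSpace) (a b : X) : X :=
  bigsup [set d : X | (ms_J d `&` a <= b)%O]%classic.

Section Classes.
Local Open Scope order_scope.

(* Not [set modalSpace]: that would make the universe of [set] larger than that
   of the carriers of modal spaces. *)
Definition MS (X : modalSpace) : Prop := True.
Definition sCoTS (X : modalSpace) : Prop :=
  forall a : X, ms_J a = \bot -> a = \bot.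
Definition TS (X : modalSpace) : Prop := forall a : X, ms_J a <= a.
Definition CoTS (X : modalSpace) : Prop := forall a : X, a <= ms_J a.
Definition sS (X : modalSpace) : Prop := sCoTS X /\ TS X.
Definition Sp (X : modalSpace) : Prop := TS X /\ CoTS X.

End Classes.

Section Models.
Local Open Scope order_scope.

Record valuation (P : Type) (X : modalSpace) := Valuation {
  val_fun :> form P -> X;
  val_top : val_fun ⊤ = \top;
  val_bot : val_fun ⊥ = \bot;
  val_and : forall A B, val_fun (A ∧ B) = val_fun A `&` val_fun B;
  val_or  : forall A B, val_fun (A ∨ B) = val_fun A `|` val_fun B;
  val_imp : forall A B, val_fun (A → B) = jimp (val_fun A) (val_fun B);
  val_J : forall A, val_fun (J A) = ms_J (val_fun A)
}.

Definition valid (P : choiceType) (C : modalSpace -> Prop)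
    (Γ : {fset form P}) (A : form P) : Prop :=
  forall X : modalSpace, C X -> forall V : valuation P X,
    \meet_(γ <- Γ) V γ <= V A.

End Models.

Notation "C ⊨ Γ ⇒ A" := (valid C Γ A%form)
  (at level 70, Γ at level 69, A at level 70, no associativity).

(* Main.v *)
(* The formulas preordered by [[fset A] ⊢ B] form a distributive lattice, in
   which J C ∧ A ⊢ B iff C ⊢ A → B; in particular J preserves finite joins,
   having ⊤ → _ as a right adjoint.  The ideals of this preorder form a frame, J
   extends to them by closing images downwards, and sending A to the principal
   ideal ↓A is a valuation for which ↓A ≤ ↓B means A ⊢ B.  Each additional rule
   yields the corresponding condition on ideals element by element, so this one
   construction settles all six logics. *)
From HB Require Import structures.
Require Import Defs.
From mathcomp Require Import all_boot all_order finmap boolp classical_sets.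

Set Implicit Arguments.
Unset Strict Implicit.
Unset Printing Implicit Defensive.

(** * Derived rules and the preorder of formulas *)

Section Derivations.
Variables (P : choiceType) (L : logic).
Implicit Types (A B C D : form P) (Γ Δ : {fset form P}).
Local Open Scope fset_scope.

(** Weakening is obtained by conjoining [A], derived from [Γ], with [⊤], derived from [Δ], and
    projecting. *)
Lemma derivable_weak Γ Δ A :
  Γ `<=` Δ -> derivable L Γ A -> derivable L Δ A.
Proof. by move=> /fsetUidPr <- /d_andI/(_ (d_top L Δ))/d_andE0. Qed.

Lemma derivable_ax Γ A : A \in Γ -> derivable L Γ A.
Proof. by rewrite -fsub1set => /derivable_weak; apply; exact: d_init. Qed.

Lemma derivable_cut Γ A B :
  derivable L Γ A -> derivable L (A |` Γ) B -> derivable L Γ B.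
Proof. by move=> dA /(d_cut dA); rewrite fsetUid. Qed.

Lemma derivable_cut1 Γ A B :
  derivable L Γ A -> derivable L [fset A] B -> derivable L Γ B.
Proof.
by move=> dA dB; apply: derivable_cut dA _; apply: derivable_weak dB; exact: fsubsetUl.
Qed.

Lemma derivable_or Γ A B C :
  derivable L (A |` Γ) C -> derivable L (B |` Γ) C ->
  derivable L ((A ∨ B)%form |` Γ) C.
Proof. by move=> dA /(d_orE dA); rewrite fsetUid. Qed.

Lemma derivable_or1 A B C :
  derivable L [fset A] C -> derivable L [fset B] C ->
  derivable L [fset (A ∨ B)%form] C.
Proof.
by move=> dA dB; have := @derivable_or fset0 A B C; rewrite !fsetU0; exact.
Qed.

Lemma derivable_orS A B C D :
  derivable L [fset A] C -> derivable L [fset B] D ->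
  derivable L [fset (A ∨ B)%form] (C ∨ D).
Proof. by move=> dC dD; apply: derivable_or1; [exact: d_orI0|exact: d_orI1]. Qed.

Lemma derivable_andl A B C :
  derivable L [fset (A ∧ B)%form] C <-> derivable L [fset A; B] C.
Proof.
split=> dC.
  by apply: derivable_cut1 dC; apply: d_andI; exact: d_init.
have dAB := d_init L (A ∧ B)%form.
(* Both conjuncts are cut against projections of [A ∧ B]; sets merge the two copies of it. *)
have := d_cut (d_andE0 dAB) dC.
by rewrite fsetUC => /(d_cut (d_andE1 dAB)); rewrite fsetUid.
Qed.

Lemma derivable_impP A B C :
  derivable L [fset C] (A → B) <-> derivable L [fset (J C ∧ A)%form] B.
Proof.
(* The rule [d_F] supplies the [J (A → B)] that [d_impE] asks for. *)
rewrite derivable_andl; split=> [/d_F dAB|]; last exact: d_impI.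
by rewrite fsetUC; apply: d_impE dAB; exact: d_init.
Qed.

Lemma derivable_J_adj B C :
  derivable L [fset J C] B <-> derivable L [fset C] (⊤ → B).
Proof.
rewrite derivable_impP derivable_andl; split=> dB.
  by apply: derivable_weak dB; exact: fsubsetUl.
by apply: (derivable_cut (d_top _ _)); rewrite fsetUC.
Qed.

Lemma derivable_J_bot : derivable L [fset J (@Bot P)] ⊥.
Proof. by apply/derivable_J_adj; apply: d_bot; exact: d_init. Qed.

(** Left adjoints preserve joins: move [J] across the adjunction, split the disjunction, move [J]
    back. *)
Lemma derivable_J_or A B : derivable L [fset J (A ∨ B)] (J A ∨ J B).
Proof.
apply/derivable_J_adj; apply: derivable_or1; apply/derivable_J_adj.
  by apply: d_orI0; exact: d_init.
by apply: d_orI1; exact: d_init.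
Qed.

Lemma derivable_J_orr A B : derivable L [fset (J A ∨ J B)%form] (J (A ∨ B)).
Proof.
by apply: derivable_or1; apply: d_F; [apply: d_orI0|apply: d_orI1]; exact: d_init.
Qed.

(** Distributivity comes from the side formulas allowed in [d_orE]: [A] stays available in both
    branches. *)
Lemma derivable_distr A B C :
  derivable L [fset (A ∧ (B ∨ C))%form] ((A ∧ B) ∨ (A ∧ C)).
Proof.
apply/derivable_andl; rewrite fsetUC; apply: derivable_or.
  apply: d_orI0; rewrite fsetUC; apply: d_andI; exact: d_init.
apply: d_orI1; rewrite fsetUC; apply: d_andI; exact: d_init.
Qed.

(** Reduces a finite context to one formula, since ideals only see entailment from a single
    formula. *)
Lemma derivable_bigand (s : seq (form P)) Γ :
  {subset s <= Γ} -> derivable L Γ (foldr (@And P) ⊤ s).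
Proof.
elim: s => [|A s IHs] /= sG; first exact: d_top.
rewrite -(fsetUid Γ); apply: d_andI.
  by apply: derivable_ax; apply: sG; exact: mem_head.
by apply: IHs => B sB; apply: sG; rewrite inE sB orbT.
Qed.

End Derivations.

(** Mere down-sets would not do: principal ones would not send [⊥] to the bottom or [∨] to joins. *)
Record ideal (P : choiceType) (L : logic) := Ideal {
  ideal_mem :> form P -> Prop;
  ideal_bot : ideal_mem ⊥%form;
  ideal_or : forall A B, ideal_mem A -> ideal_mem B -> ideal_mem (A ∨ B)%form;
  ideal_down : forall A B,
    derivable L [fset A]%fset B -> ideal_mem B -> ideal_mem A
}.

(** * The frame of ideals *)

Section IdealFrame.
Variables (P : choiceType) (L : logic).
Implicit Types (I K M : ideal P L) (A B C : form P).
Local Open Scope classical_set_scope.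

Lemma idealP I K : (forall A, I A <-> K A) -> I = K.
Proof.
case: I K => [I ? ? ?] [K ? ? ?] /= IK.
have {}IK : I = K by apply: funext => A; apply: propext.
by subst K; f_equal; exact: Prop_irrelevance.
Qed.

HB.instance Definition _ := gen_eqMixin (ideal P L).
HB.instance Definition _ := gen_choiceMixin (ideal P L).

Definition ideal_le I K : bool := `[< forall A, I A -> K A >].

Lemma ideal_le_refl : reflexive ideal_le.
Proof. by move=> I; apply/asboolP. Qed.

Lemma ideal_le_anti : antisymmetric ideal_le.
Proof.
move=> I K /andP[/asboolP IK /asboolP KI].
by apply: idealP => A; split=> [/IK|/KI].
Qed.

Lemma ideal_le_trans : transitive ideal_le.
Proof.
by move=> K I M /asboolP IK /asboolP KM; apply/asboolP; move=> A /IK /KM.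
Qed.

HB.instance Definition _ := Order.Le_isPOrder.Build (Order.Disp tt tt)
  (ideal P L) ideal_le_refl ideal_le_anti ideal_le_trans.

Lemma leidP I K : reflect (forall A, I A -> K A) (I <= K)%O.
Proof. exact: asboolP. Qed.

#[local] Obligation Tactic := idtac.

Program Definition ideal_meet I K : ideal P L :=
  @Ideal P L (fun A => I A /\ K A) _ _ _.
Next Obligation. by move=> I K; split; exact: ideal_bot. Qed.
Next Obligation.
by move=> I K A B [? ?] [? ?]; split; exact: ideal_or.
Qed.
Next Obligation.
by move=> I K A B dB [? ?]; split; exact: ideal_down dB _.
Qed.

(** The ideal generated by the union, encoded impredicatively: using a member means choosing a
    suitable [K], with no finite disjunctions to handle. *)
Program Definition ideal_sup (S : set (ideal P L)) : ideal P L :=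
  @Ideal P L
    (fun A => forall K, (forall I, S I -> forall B, I B -> K B) -> K A) _ _ _.
Next Obligation. by move=> S K _; exact: ideal_bot. Qed.
Next Obligation.
by move=> S A B SA SB K SK; apply: ideal_or; [exact: SA|exact: SB].
Qed.
Next Obligation.
by move=> S A B dB SB K SK; apply: ideal_down dB _; exact: SB.
Qed.

Program Definition ideal_principal B : ideal P L :=
  @Ideal P L (fun A => derivable L [fset A]%fset B) _ _ _.
Next Obligation. by move=> B; apply: d_bot; exact: d_init. Qed.
Next Obligation. by move=> B A C; exact: derivable_or1. Qed.
Next Obligation. by move=> B A C; exact: derivable_cut1. Qed.

Lemma ideal_sup_isLub (S : set (ideal P L)) : isLub S (ideal_sup S).
Proof.
split=> [I SI|K SK]; apply/leidP=> A.
  by move=> IA K SK; exact: SK IA.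
by apply=> I SI; apply/leidP; exact: SK.
Qed.

Lemma ideal_lexI I K M : (I <= ideal_meet K M)%O = (I <= K)%O && (I <= M)%O.
Proof.
apply/leidP/andP => [IKM|[/leidP IK /leidP IM] A IA].
  by split; apply/leidP => A /IKM[].
by split; [exact: IK|exact: IM].
Qed.

Lemma ideal_leUx I K M :
  (ideal_sup [set I; K] <= M)%O = (I <= M)%O && (K <= M)%O.
Proof.
have [ub lub] := ideal_sup_isLub [set I; K].
apply/idP/andP => [SM|[IM KM]]; last by apply: lub => _ [->|->].
by split; apply: Order.POrderTheory.le_trans SM; apply: ub; [left|right].
Qed.

HB.instance Definition _ := Order.POrder_isMeetSemilattice.Build
  (Order.Disp tt tt) (ideal P L) ideal_lexI.
HB.instance Definition _ := Order.POrder_isJoinSemilattice.Build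
  (Order.Disp tt tt) (ideal P L) ideal_leUx.

(** With the principal ideals of [⊥] and [⊤] as bottom and top, those two clauses of a valuation
    hold by [erefl]. *)
Lemma principal_bot_le I : (ideal_principal ⊥ <= I)%O.
Proof. by apply/leidP => A /ideal_down; apply; exact: ideal_bot. Qed.

Lemma le_principal_top I : (I <= ideal_principal ⊤)%O.
Proof. by apply/leidP => A _; exact: d_top. Qed.

HB.instance Definition _ := Order.hasBottom.Build
  (Order.Disp tt tt) (ideal P L) principal_bot_le.
HB.instance Definition _ := Order.hasTop.Build
  (Order.Disp tt tt) (ideal P L) le_principal_top.

(* Heyting implication of the frame; its existence makes meets distribute over
   sups. *)
Program Definition ideal_residual I K : ideal P L :=
  @Ideal P L (fun B => forall A, I A -> K (A ∧ B)%form) _ _ _.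
Next Obligation.
move=> I K A _; apply: ideal_down (ideal_bot K).
by apply: d_andE1; exact: d_init.
Qed.
Next Obligation.
move=> I K B C KB KC A IA; apply: ideal_down (derivable_distr L _ _ _) _.
by apply: ideal_or; [exact: KB|exact: KC].
Qed.
Next Obligation.
move=> I K B C dC KC A IA; apply: ideal_down (KC _ IA).
apply/derivable_andl; apply: d_andI => //; exact: d_init.
Qed.

Lemma ideal_meet_sup I (S : set (ideal P L)) :
  (I `&` ideal_sup S)%O = ideal_sup [set (I `&` K)%O | K in S].
Proof.
apply: idealP => A; split=> [[IA SA] M SM|SA].
  (* The sup is tested against the residual; taken at [A] itself this gives [M (A ∧ A)], and [A]
     entails [A ∧ A]. *)
  have /(_ A IA) : ideal_residual I M A.
    apply: SA => K SK B KB C IC; apply: (SM (I `&` K)%O); first by exists K.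
    split; [apply: ideal_down IC|apply: ideal_down KB].
      by apply: d_andE0; exact: d_init.
    by apply: d_andE1; exact: d_init.
  by apply: ideal_down; rewrite -[[fset A]%fset]fsetUid; apply: d_andI; exact: d_init.
apply: SA => _ [K SK <-] B [IB KB]; split=> // M SM; exact: SM KB.
Qed.

HB.instance Definition _ := TBLattice_isFrame.Build
  (Order.Disp tt tt) (ideal P L) ideal_sup_isLub ideal_meet_sup.

(** * The modality on ideals *)

Program Definition ideal_J I : ideal P L :=
  @Ideal P L (fun A => exists2 B, I B & derivable L [fset A]%fset (J B)) _ _ _.
Next Obligation.
by move=> I; exists ⊥%form; [exact: ideal_bot|apply: d_bot; exact: d_init].
Qed.
Next Obligation.
(* The downward closure of the image is already closed under [∨], as [J B ∨ J B'] entails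
   [J (B ∨ B')]. *)
move=> I A A' [B IB dB] [B' IB' dB']; exists (B ∨ B')%form; first exact: ideal_or.
exact: derivable_cut1 (derivable_orS dB dB') (derivable_J_orr L _ _).
Qed.
Next Obligation.
by move=> I A B dB [C IC dC]; exists C => //; exact: derivable_cut1 dB dC.
Qed.

(* Right adjoint of [ideal_J], whence [ideal_J_sup]. *)
Program Definition ideal_J_preimage K : ideal P L :=
  @Ideal P L (fun A => K (J A)) _ _ _.
Next Obligation.
by move=> K; apply: ideal_down (derivable_J_bot P L) (ideal_bot K).
Qed.
Next Obligation.
move=> K A B KA KB.
exact: ideal_down (derivable_J_or L _ _) (ideal_or KA KB).
Qed.
Next Obligation. by move=> K A B /d_F; exact: ideal_down. Qed.

Lemma ideal_J_mono : {homo ideal_J : I K / (I <= K)%O}.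
Proof.
by move=> I K /leidP IK; apply/leidP => A [B /IK KB dB]; exists B.
Qed.

Lemma ideal_J_sup (S : set (ideal P L)) :
  ideal_J (bigsup S) = bigsup [set ideal_J I | I in S].
Proof.
apply: idealP => A; split=> [[B SB dB] K SK|SA].
  apply: ideal_down dB _; apply: (SB (ideal_J_preimage K)) => I SI C IC.
  apply: (SK (ideal_J I)); first by exists I.
  by exists C => //; exact: d_init.
apply: SA => _ [I SI <-] B [C IC dC]; exists C => // K SK; exact: SK IC.
Qed.

Definition ideal_space : modalSpace := ModalSpace ideal_J_mono ideal_J_sup.

(** * Principal ideals as a valuation *)

Lemma principal_leP A B :
  reflect (derivable L [fset A]%fset B) (ideal_principal A <= ideal_principal B)%O.
Proof.
apply: (iffP (leidP _ _)) => [|dB C]; first by apply; exact: d_init.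
by move=> dA; exact: derivable_cut1 dA dB.
Qed.

Lemma principal_and A B :
  ideal_principal (A ∧ B) = (ideal_principal A `&` ideal_principal B)%O.
Proof.
apply: idealP => C; split=> [dAB|[dA dB]].
  by split; [exact: d_andE0 dAB|exact: d_andE1 dAB].
by rewrite /= -[[fset C]%fset]fsetUid; exact: d_andI.
Qed.

Lemma principal_or A B :
  ideal_principal (A ∨ B) = (ideal_principal A `|` ideal_principal B)%O.
Proof.
apply: idealP => C; split=> [dC K SK|].
  apply: ideal_down dC _; apply: ideal_or.
    by apply: (SK (ideal_principal A)); [left|exact: d_init].
  by apply: (SK (ideal_principal B)); [right|exact: d_init].
by apply=> _ [->|->] D /= dD; [exact: d_orI0|exact: d_orI1].
Qed.

Lemma principal_J A : ideal_principal (J A) = ideal_J (ideal_principal A).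
Proof.
apply: idealP => B; split=> [dB|[C dC dB]]; first by exists A => //; exact: d_init.
exact: derivable_cut1 dB (d_F dC).
Qed.

Lemma principal_imp A B : ideal_principal (A → B) =
  jimp (ideal_principal A : ideal_space) (ideal_principal B).
Proof.
apply: idealP => C; split=> [dC K SK|].
  (* The ideal of [A → B] is itself one of those joined: [J (A → B) ∧ A] entails [B]. *)
  apply: (SK (ideal_principal (A → B))); last exact: dC.
  rewrite /= -principal_J -principal_and; apply/principal_leP.
  by apply/derivable_impP; exact: d_init.
(* Conversely, the sup is tested against the ideal of [A → B]: for [D] in [I], the formula [J D ∧ A]
   lies in both [ideal_J I] and the ideal of [A]. *)
apply=> I /leidP IAB D ID; apply/derivable_impP; apply: IAB; split.
  by exists D => //; apply: d_andE0; exact: d_init.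
by apply: d_andE1; exact: d_init.
Qed.

Definition ideal_valuation : valuation P ideal_space :=
  @Valuation P ideal_space ideal_principal erefl erefl
    principal_and principal_or principal_imp principal_J.

(** * From additional rules to conditions on ideals *)

Lemma ideal_space_sCoTS : L rsCoJ -> sCoTS ideal_space.
Proof.
move=> LsCoJ I JI0; apply: idealP => A; split=> [IA|]; last first.
  by move/ideal_down; apply; exact: ideal_bot.
apply: (d_sCoJ LsCoJ).
(* [J A] lies in [ideal_J I], which is the ideal of [⊥] by assumption, so [J A] entails [⊥]. *)
suff : ideal_principal ⊥ (J A) by [].
have <- : ideal_J I = ideal_principal ⊥ := JI0.
by exists A => //; exact: d_init.
Qed.

Lemma ideal_space_TS : L rJ -> TS ideal_space.
Proof.
move=> LrJ I; apply/leidP => A [B IB dB].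
by apply: ideal_down IB; exact: d_J.
Qed.

Lemma ideal_space_CoTS : L rCoJ -> CoTS ideal_space.
Proof.
move=> LCoJ I; apply/leidP => A IA.
by exists A => //; apply: d_CoJ => //; exact: d_init.
Qed.

End IdealFrame.

(** * Completeness from the ideal model *)

Lemma valuation_bigand (P : choiceType) (X : modalSpace) (V : valuation P X)
    (s : seq (form P)) :
  V (foldr (@And P) ⊤%form s) = (\meet_(A <- s) V A)%O.
Proof.
by elim: s => [|A s IHs] /=; rewrite ?big_nil ?big_cons ?val_top // val_and IHs.
Qed.

(** In the ideal model the meet over [Γ] is the principal ideal of its conjunction, so validity
    there says that the conjunction entails [A]; a cut finishes. *)
Lemma ideal_completeness (P : choiceType) (L : logic) (C : modalSpace -> Prop)
    (Γ : {fset form P}) (A : form P) :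
  C (ideal_space P L) -> C ⊨ Γ ⇒ A -> Γ ⊢[L] A.
Proof.
move=> CL /(_ _ CL (ideal_valuation P L)).
rewrite -valuation_bigand => /principal_leP; apply: derivable_cut1.
exact: derivable_bigand.
Qed.

Theorem theorem5p4 (P : choiceType) (Γ : {fset form P}) (A : form P) :
  (MS ⊨ Γ ⇒ A -> Γ ⊢[mJ] A) /\
  (sCoTS ⊨ Γ ⇒ A -> Γ ⊢[sCoJ] A) /\
  (CoTS ⊨ Γ ⇒ A -> Γ ⊢[CoJ] A) /\
  (TS ⊨ Γ ⇒ A -> Γ ⊢[LJ] A) /\
  (sS ⊨ Γ ⇒ A -> Γ ⊢[sI] A) /\
  (Sp ⊨ Γ ⇒ A -> Γ ⊢[LI] A).
Proof.
do ![split]; apply: ideal_completeness => //.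
- exact: ideal_space_sCoTS.
- exact: ideal_space_CoTS.
- exact: ideal_space_TS.
- by split; [apply: ideal_space_sCoTS; left|apply: ideal_space_TS; right].
- by split; [apply: ideal_space_TS; left|apply: ideal_space_CoTS; right].
Qed.
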